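(* Let $n\ge1$ be an integer, $\alpha>1$ real, and for $x\in\mathbb{C}$ with $|x|=1$, $x\neq-1$, let $B_n(\alpha,x)=F(1-n,1-\alpha;2;1+x)$. Then $$|B_n(\alpha,x)|\le|B_n(\alpha,1)|.$$
   Context: $F(a,b;c;z)=\sum_{k=0}^\infty\frac{(a)_k(b)_k}{(c)_k\,k!}z^k$ is the Gaussian hypergeometric function, $(a)_k=a(a+1)\cdots(a+k-1)$, $(a)_0=1$. Since $1-n$ is a non-positive integer, $F(1-n,1-\alpha;2;\cdot)$ is a polynomial. *)

(* Defs.v *)
From HB Require Import structures.
From mathcomp Require Import all_boot all_order all_algebra.
From mathcomp Require Import all_classical all_reals all_analysis.
From mathcomp Require Import complex.
Set Implicit Arguments.
Unset Strict Implicit.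
Unset Printing Implicit Defensive.
Import Order.TTheory GRing.Theory Num.Theory.
Import numFieldNormedType.Exports.
Local Open Scope ring_scope.
Local Open Scope classical_set_scope.

Definition pochhammer (K : numFieldType) (a : K) (k : nat) : K :=
  \prod_(i < k) (a + i%:R).

Definition hyp2F1_term (K : numFieldType) (a b c z : K) (k : nat) : K :=
  pochhammer a k * pochhammer b k / (pochhammer c k * k`!%:R) * z ^+ k.

(* The limit is taken in the topology of the norm of K.  As usual [limn] is
   unspecified when the series diverges. *)
Definition hyp2F1 (K : numFieldType) (a b c z : K) : K :=
  limn (series (hyp2F1_term a b c z)).

Definition Bn (R : realType) (n : nat) (alpha : R) (x : R[i]) : R[i] :=
  hyp2F1 (1 - n%:R) (1 - (alpha%:C)%C) 2 (1 + x).

(* Main.v *)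
(** Put [w = 1 + x], [t = |w|^2 / 4] and
      [c_n = n B_n(alpha, x) = sum_k C(n, k+1) C(alpha-1, k) w^k].
    Pascal's rule gives a three-term recurrence for [c_n] and the relation
    [c_{n+1}(alpha+1) - c_n(alpha+1) = c_{n+1}(alpha) + x c_n(alpha)]; by the
    triangle inequality the latter reduces the claim to [1 <= alpha < 2].

    On the unit circle the recurrence yields
      [|c_n|^2 = sum_k g_k n C(n+k, 2k+1) t^k],
      [g_k = prod_(1 <= j <= k) 4 (alpha^2 - j^2) / (j (j+1))],
    and the [t]-derivative of the right-hand side is [2 (alpha^2 - 1) n] times
      [sum_k mu_k (-4)^k C(n+k+1, 2k+3) t^k],
      [mu_k = prod_(2 <= j <= k+1) (j^2 - alpha^2) / (j^2 - 1)].
    Without the [mu_k] this sum is [(n - U_{n-1}(1 - 2t)) / (4t) >= 0], where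
    [U] is the Chebyshev polynomial.  Multiplying the [k]-th coefficient by
    [1 / (k + c)], [c > 0], preserves nonnegativity on [[0, 1]], hence so does
    multiplying it by
      [((k+y)^2 - 1) / ((k+y)^2 - alpha^2)
         = 1 + (alpha^2 - 1) / ((k+y-alpha) (k+y+alpha))], [y >= 2],
    and [mu_k] is the limit of normalised products of these factors over
    [y = 2, 3, ...].  So [|c_n|^2] increases with [t] and is largest at [t = 1],
    that is, at [x = 1]. *)
Require Import Defs.
From mathcomp Require Import all_boot all_order all_algebra.
From mathcomp Require Import all_classical all_reals all_analysis.
From mathcomp Require Import complex polyrcf ring lra zify.
Import Order.TTheory GRing.Theory Num.Theory.
Import numFieldNormedType.Exports.
Set Implicit Arguments.
Unset Strict Implicit.
Unset Printing Implicit Defensive.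
Local Open Scope ring_scope.

(** * Generalised binomial coefficients and the recurrences for [c_n] *)

Definition gbinom (K : numFieldType) (b : K) (k : nat) : K :=
  (\prod_(i < k) (b - i%:R)) / k`!%:R.

Lemma gbinom0 (K : numFieldType) (b : K) : gbinom b 0 = 1.
Proof. by rewrite /gbinom big_ord0 fact0 divr1. Qed.

Lemma gbinomS (K : numFieldType) (b : K) (k : nat) :
  k.+1%:R * gbinom b k.+1 = (b - k%:R) * gbinom b k.
Proof.
rewrite /gbinom big_ord_recr /= factS natrM.
have h1 : (k`!%:R : K) != 0 by rewrite pnatr_eq0 -lt0n fact_gt0.
have h2 : (k.+1%:R : K) != 0 by rewrite pnatr_eq0.
by move: (k.+1%:R : K) (k`!%:R : K) h1 h2 => v w h1 h2; field; rewrite h1 h2.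
Qed.

Lemma gbinomD1 (K : numFieldType) (b : K) (k : nat) :
  gbinom (b + 1) k.+1 = gbinom b k.+1 + gbinom b k.
Proof.
elim: k => [|k IHk].
  have e (u : K) : gbinom u 1 = u.
    by have := gbinomS u 0; rewrite gbinom0 subr0 mulr1 mul1r.
  by rewrite !e gbinom0.
have h : (k.+2%:R : K) != 0 by rewrite pnatr_eq0.
have h1 : (k.+1%:R : K) != 0 by rewrite pnatr_eq0.
apply: (mulfI h); rewrite mulrDr !gbinomS IHk.
have := gbinomS b k; rewrite -(natr1 k.+1) -(natr1 k) in h h1 * => e.
have -> : gbinom b k.+1 = (b - k%:R) * gbinom b k / (k%:R + 1).
  by rewrite -e mulrC mulKf.
by field.
Qed.

(* Equal to [n B_n(alpha, x)]. *)
Definition binom_sum (K : numFieldType) (alpha : K) (n : nat) (x : K) : K :=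
  \sum_(k < n) 'C(n, k.+1)%:R * (gbinom (alpha - 1) k * (1 + x) ^+ k).

(** The added terms carry [C(n, k+1) = 0]; a common range lets sums for different [n] be combined
    termwise. *)
Lemma binom_sumE (K : numFieldType) (alpha : K) (n : nat) (x : K) (N : nat) :
  (n <= N)%N ->
  binom_sum alpha n x =
    \sum_(k < N) 'C(n, k.+1)%:R * (gbinom (alpha - 1) k * (1 + x) ^+ k).
Proof.
move=> nN; rewrite /binom_sum (big_ord_widen N (fun k => 'C(n, k.+1)%:R * (gbinom (alpha - 1) k * (1 + x) ^+ k))) //.
rewrite big_mkcond; apply: eq_bigr => k _; case: ltnP => // nk.
by rewrite bin_small // mul0r.
Qed.

Lemma binom_sum0 (K : numFieldType) (alpha x : K) : binom_sum alpha 0 x = 0.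
Proof. by rewrite /binom_sum big_ord0. Qed.

Lemma binom_sum1 (K : numFieldType) (alpha x : K) : binom_sum alpha 1 x = 1.
Proof. by rewrite /binom_sum big_ord1 gbinom0 expr0 bin1 !mulr1. Qed.

Lemma bin_diff2 (K : numFieldType) (m k : nat) :
  'C(m.+2, k.+2)%:R - 2 * 'C(m.+1, k.+2)%:R + 'C(m, k.+2)%:R
   = 'C(m, k)%:R :> K.
Proof. rewrite !binS !natrD; ring. Qed.

Lemma binom_sum_rec (K : numFieldType) (alpha : K) (m : nat) (x : K) :
  m.+1%:R * binom_sum alpha m.+2 x =
  (alpha * (1 + x) + m.+1%:R * (1 - x)) * binom_sum alpha m.+1 x
  + m.+1%:R * x * binom_sum alpha m x.
Proof.
(* The recurrence in second-difference form. By [bin_diff2] and an index shift, the coefficient of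
   [(1 + x)^(k+1)] on both sides is [(alpha - 1 - k) C(m+1, k+1) gbinom (alpha - 1) k]. *)
have key : m.+1%:R * (binom_sum alpha m.+2 x - 2 * binom_sum alpha m.+1 x + binom_sum alpha m x) =
  (1 + x) * ((alpha - m.+1%:R) * binom_sum alpha m.+1 x + m.+1%:R * binom_sum alpha m x).
  rewrite [LHS](_ : _ = m.+1%:R * \sum_(k < m.+2)
    ('C(m.+2, k.+1)%:R - 2 * 'C(m.+1, k.+1)%:R + 'C(m, k.+1)%:R) *
     (gbinom (alpha - 1) k * (1 + x) ^+ k)); last first.
    rewrite (@binom_sumE K alpha m.+1 x m.+2 (leqnSn _)).
    rewrite (@binom_sumE K alpha m x m.+2 (leqW (leqnSn _))).
    rewrite /binom_sum mulr_sumr -sumrB -big_split /=; congr (_ * _).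
    apply: eq_bigr => k _. ring.
  rewrite (@binom_sumE K alpha m x m.+1 (leqnSn _)) /binom_sum !mulr_sumr -big_split /= mulr_sumr.
  rewrite big_ord_recl /= !bin1 -!(natr1 m.+1) -(natr1 m).
  rewrite [X in X + _](_ : _ = 0) ?add0r; last ring.
  apply: eq_bigr => k _.
  rewrite /bump /= add1n bin_diff2 exprS.
  have e1 : (m%:R + 1) * 'C(m, k)%:R = k.+1%:R * 'C(m.+1, k.+1)%:R :> K.
    by rewrite natr1 -!natrM mul_bin_diag.
  have e2 : (m%:R + 1) * 'C(m, k.+1)%:R = (m%:R - k%:R) * 'C(m.+1, k.+1)%:R :> K.
    apply/eqP; rewrite mulrBl -subr_eq0; apply/eqP.
    transitivity ((m%:R + 1) * ('C(m, k.+1)%:R + 'C(m, k)%:R) - (m%:R + 1) * 'C(m.+1, k.+1)%:R :> K).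
      rewrite mulrDr e1 -(natr1 k); ring.
    by rewrite binS natrD; ring.
  have e3 := gbinomS (alpha - 1) k.
  transitivity ((m%:R + 1) * 'C(m, k)%:R * gbinom (alpha - 1) k.+1 *
    ((1 + x) * (1 + x) ^+ k)); first ring.
  rewrite e1.
  transitivity (k.+1%:R * gbinom (alpha - 1) k.+1 * 'C(m.+1, k.+1)%:R *
    ((1 + x) * (1 + x) ^+ k)); first ring.
  rewrite e3.
  rewrite [RHS](_ : _ = (1 + x) * ((alpha - (m%:R + 1)) * 'C(m.+1, k.+1)%:R +
     (m%:R + 1) * 'C(m, k.+1)%:R) * (gbinom (alpha - 1) k * (1 + x) ^+ k)); last ring.
  rewrite e2; ring.
transitivity (m.+1%:R * (binom_sum alpha m.+2 x - 2 * binom_sum alpha m.+1 x + binom_sum alpha m x) + m.+1%:R * (2 * binom_sum alpha m.+1 x - binom_sum alpha m x)); first ring.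
rewrite key; ring.
Qed.

Lemma binom_sum_diff (K : numFieldType) (alpha : K) (n : nat) (x : K) :
  binom_sum alpha n.+1 x - binom_sum alpha n x =
    \sum_(k < n.+1) 'C(n, k)%:R * (gbinom (alpha - 1) k * (1 + x) ^+ k).
Proof.
rewrite (@binom_sumE K alpha n x n.+1 (leqnSn _)) /binom_sum -sumrB.
by apply: eq_bigr => k _; rewrite -mulrBl binS natrD addrAC subrr add0r.
Qed.

(** Splitting [c_{n+1} + x c_n] as [(c_{n+1} - c_n) + (1 + x) c_n] makes this Pascal's rule in the
    upper index [alpha - 1], term by term. *)
Lemma binom_sum_succ (K : numFieldType) (alpha : K) (n : nat) (x : K) :
  binom_sum (alpha + 1) n.+1 x =
  binom_sum (alpha + 1) n x + (binom_sum alpha n.+1 x + x * binom_sum alpha n x).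
Proof.
have -> : binom_sum alpha n.+1 x + x * binom_sum alpha n x =
   (binom_sum alpha n.+1 x - binom_sum alpha n x) + (1 + x) * binom_sum alpha n x by ring.
apply: (addIr (- binom_sum (alpha + 1) n x)); rewrite [RHS]addrAC subrr add0r.
rewrite !binom_sum_diff big_ord_recl [in RHS]big_ord_recl /= !gbinom0 !mulr1.
rewrite -[RHS]addrA; congr (_ + _); rewrite /binom_sum mulr_sumr -big_split /=; apply: eq_bigr => k _.
rewrite /bump /= add1n exprS.
have := gbinomD1 (alpha - 1) k; rewrite subrK addrK => ->; ring.
Qed.

(** * Expansion of [|c_n|^2] in powers of [t] *)

Definition normsq_ratio (K : numFieldType) (alpha : K) (k : nat) : K :=
  \prod_(j < k) (4 * (alpha ^+ 2 - j.+1%:R ^+ 2) / (j.+1%:R * j.+2%:R)).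

(** The length [N] is kept apart from [n] so that sums for neighbouring [n] share one range; terms
    with [k >= n] vanish. *)
Definition normsq_sum (K : numFieldType) (alpha t : K) (N n : nat) : K :=
  \sum_(k < N) normsq_ratio alpha k * (n * 'C(n + k, k.*2.+1))%:R * t ^+ k.

(* [c_{n+1} c_n^* = (1 + x) alpha re_sum + (1 - x) im_sum]: up to a rotation these
   are the real and imaginary parts of [c_{n+1} c_n^*]. *)
Definition re_sum (K : numFieldType) (alpha t : K) (N n : nat) : K :=
  \sum_(k < N) normsq_ratio alpha k * 'C(n + k.+1, k.*2.+2)%:R * t ^+ k.

Definition im_sum (K : numFieldType) (alpha t : K) (N n : nat) : K :=
  \sum_(k < N) normsq_ratio alpha k * (k.+1 * 'C(n + k.+1, k.*2.+2))%:R * t ^+ k.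

(** By Pascal the bracket is [C(n+k, 2k+1) + 2 C(n+k, 2k+2)], and [(2k+2) C(n+k, 2k+2) = (n-k-1)
    C(n+k, 2k+1)] when [2k+1 <= n+k]. This ties the coefficients of [normsq_sum] to those of
    [re_sum] and [im_sum]. *)
Lemma mul_bin_odd (n k : nat) :
  (n * 'C(n + k, k.*2.+1) =
   k.+1 * ('C(n + k.+1, k.*2.+2) + 'C(n + k, k.*2.+2)))%N.
Proof.
have h2 := mul_bin_left (n + k) k.*2.+1.
rewrite addnS binS; case: (leqP k.*2.+1 (n + k)) => h.
  have [d hd] : exists d, n = (k.+1 + d)%N by exists (n - k.+1)%N; lia.
  have e : (n + k - k.*2.+1 = d)%N by lia.
  rewrite e in h2; rewrite {1}hd mulnDl -h2 -mul2n; ring.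
rewrite (@bin_small (n + k) k.*2.+1) // (@bin_small (n + k) k.*2.+2) ?muln0 //.
exact: leqW.
Qed.

Lemma normsq_sum0 (K : numFieldType) (alpha t : K) (N : nat) : normsq_sum alpha t N 0 = 0.
Proof. by rewrite /normsq_sum big1 // => k _; rewrite mul0n mulr0 mul0r. Qed.

Lemma normsq_sum1 (K : numFieldType) (alpha t : K) (N : nat) :
  normsq_sum alpha t N.+1 1 = 1.
Proof.
rewrite /normsq_sum big_ord_recl /normsq_ratio big_ord0 /= bin1 expr0 !mulr1.
by rewrite big1 ?addr0 // => k _; rewrite bin_small ?mulr0 ?mul0r // /bump; lia.
Qed.

Lemma re_sum0 (K : numFieldType) (alpha t : K) (N : nat) : re_sum alpha t N 0 = 0.
Proof.
by rewrite /re_sum big1 // => k _; rewrite bin_small ?mulr0 ?mul0r //; lia.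
Qed.

Lemma im_sum0 (K : numFieldType) (alpha t : K) (N : nat) : im_sum alpha t N 0 = 0.
Proof.
by rewrite /im_sum big1 // => k _; rewrite bin_small ?muln0 ?mulr0 ?mul0r //; lia.
Qed.

Lemma normsq_sumS (K : numFieldType) (alpha t : K) (N n : nat) :
  normsq_sum alpha t N n.+1 = im_sum alpha t N n.+1 + im_sum alpha t N n.
Proof.
rewrite /normsq_sum /im_sum -big_split; apply: eq_bigr => k _ /=.
by rewrite mul_bin_odd mulnDr natrD natrM -[(n + k.+1)%N]addSnnS !natrM; ring.
Qed.

Lemma re_sumS (K : numFieldType) (alpha t : K) (N n : nat) :
  n.+1%:R * (re_sum alpha t N n.+1 - re_sum alpha t N n) = normsq_sum alpha t N n.+1.
Proof.
rewrite /normsq_sum /re_sum -sumrB mulr_sumr; apply: eq_bigr => k _.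
by rewrite -[(n + k.+1)%N]addSnnS addnS binS natrD natrM; ring.
Qed.

Lemma bin_diff3 (K : numFieldType) (m k : nat) :
  'C(m.+3, k.+3)%:R - 3 * 'C(m.+2, k.+3)%:R + 3 * 'C(m.+1, k.+3)%:R
  - 'C(m, k.+3)%:R = 'C(m, k)%:R :> K.
Proof. rewrite !binS !natrD; ring. Qed.

(** Comparison of coefficients: in [g_{k+1} / g_k = 4 (alpha^2 - (k+1)^2) / ((k+1)(k+2))] the part
    with [alpha^2] produces the [re_sum] terms ([dX]) and the part with [(k+1)^2] the [im_sum] terms
    ([dS]). *)
Lemma normsq_sum_rec (K : numFieldType) (alpha t : K) (N n : nat) :
  (n.+1 <= N)%N ->
  normsq_sum alpha t N.+1 n.+2 = normsq_sum alpha t N.+1 n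
   + 4 * (1 - t) * (im_sum alpha t N.+1 n.+1 - im_sum alpha t N.+1 n)
   + 4 * t * (alpha ^+ 2 / n.+1%:R * (re_sum alpha t N.+1 n.+1 + re_sum alpha t N.+1 n)).
Proof.
move=> nN.
pose F k : K := 'C(n.+1 + k, k.*2.+1)%:R.
have n0 : (n.+1%:R : K) != 0 by rewrite pnatr_eq0.
have kk0 (k : nat) : (k.+1%:R : K) != 0 by rewrite pnatr_eq0.
have dX : alpha ^+ 2 / n.+1%:R * (re_sum alpha t N.+1 n.+1 + re_sum alpha t N.+1 n)
    = \sum_(k < N.+1) normsq_ratio alpha k * (alpha ^+ 2 / k.+1%:R) * F k * t ^+ k.
  rewrite /re_sum -big_split mulr_sumr; apply: eq_bigr => k _ /=.
  have := mul_bin_odd n.+1 k; rewrite (addSnnS n k) => /(congr1 (fun m => m%:R : K)).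
  rewrite !natrM natrD /F (addSnnS n k) => e.
  transitivity (normsq_ratio alpha k * (alpha ^+ 2 / n.+1%:R / k.+1%:R) *
    (k.+1%:R * ('C(n.+1 + k.+1, k.*2.+2)%:R + 'C(n + k.+1, k.*2.+2)%:R)) * t ^+ k).
    by move: (n.+1%:R : K) (k.+1%:R : K) n0 (kk0 k) => u v u0 v0; field; rewrite u0 v0.
  rewrite -e.
  by move: (n.+1%:R : K) (k.+1%:R : K) n0 (kk0 k) => u v u0 v0; field; rewrite u0 v0.
have dS : im_sum alpha t N.+1 n.+1 - im_sum alpha t N.+1 n
    = \sum_(k < N.+1) normsq_ratio alpha k * k.+1%:R * F k * t ^+ k.
  rewrite /im_sum -sumrB; apply: eq_bigr => k _ /=.
  by rewrite /F (addSnnS n k) addSn binS !natrM natrD; ring.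
have dD : normsq_sum alpha t N.+1 n.+2 - normsq_sum alpha t N.+1 n
    - 4 * (im_sum alpha t N.+1 n.+1 - im_sum alpha t N.+1 n)
    = \sum_(k < N) normsq_ratio alpha k.+1 * k.+2%:R * F k * t ^+ k.+1.
  transitivity (\sum_(k < N.+1) normsq_ratio alpha k *
    ((n.+2 * 'C(n.+2 + k, k.*2.+1))%:R - (n * 'C(n + k, k.*2.+1))%:R
     - 4 * (k.+1%:R * F k)) * t ^+ k).
    rewrite dS /normsq_sum mulr_sumr -!sumrB; apply: eq_bigr => k _ /=; ring.
  rewrite big_ord_recl /F /= !addn0 !bin1 [X in X + _ = _](_ : _ = 0); last first.
    by rewrite !natrM -(natr1 n.+1) -(natr1 n); ring.
  rewrite add0r; apply: eq_bigr => k _; rewrite /bump /= add1n.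
  have h3 : (n.+2 * 'C(n.+2 + k.+1, k.+1.*2.+1))%:R
      - (n * 'C(n + k.+1, k.+1.*2.+1))%:R - 4 * (k.+2%:R * 'C(n.+1 + k.+1, k.+1.*2.+1)%:R)
      = k.+2%:R * 'C(n.+1 + k, k.*2.+1)%:R :> K.
    rewrite !mul_bin_odd 2!natrM 2!natrD doubleS !addnS !addSn -(bin_diff3 K (n + k).+1 k.*2.+1).
    have h4 : 'C((n + k).+3, k.*2.+4)%:R
        = 'C((n + k).+2, k.*2.+4)%:R + 'C((n + k).+2, k.*2.+3)%:R :> K.
      by rewrite binS natrD.
    by rewrite h4; ring.
  rewrite h3; ring.
apply/eqP; rewrite -subr_eq0; apply/eqP.
transitivity ((normsq_sum alpha t N.+1 n.+2 - normsq_sum alpha t N.+1 n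
    - 4 * (im_sum alpha t N.+1 n.+1 - im_sum alpha t N.+1 n))
  + 4 * t * (im_sum alpha t N.+1 n.+1 - im_sum alpha t N.+1 n)
  - 4 * t * (alpha ^+ 2 / n.+1%:R * (re_sum alpha t N.+1 n.+1 + re_sum alpha t N.+1 n))).
  ring.
rewrite dD dS dX !mulr_sumr -addrA -sumrB big_ord_recr /=.
(* The surplus term [k = N] carries [C(n+1+N, 2N+1)], which is zero because [n < N]. *)
rewrite [X in _ + (_ + X)](_ : _ = 0) ?addr0; last first.
  by rewrite /F bin_small ?mulr0 ?mul0r ?mulr0 ?subr0 //; lia.
rewrite -big_split big1 // => k _ /=.
rewrite /normsq_ratio big_ord_recr /= -/(normsq_ratio _ _) (exprS t).
have := kk0 k; have := kk0 k.+1.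
rewrite -(natr1 k.+1) -(natr1 k) => h1 h2.
move: (F k) (k%:R : K) h1 h2 => f u h1 h2.
by field; rewrite h1 h2.
Qed.

(** Conjugation fixes [alpha] and inverts [x]. Expanding [|c_{m+2}|^2] by the recurrence involves
    the products of [c_{m+1}] and [c_m] with each other's conjugates, so the induction carries these
    along with the two squared moduli. *)
Lemma binom_sum_sqr_norm (K : numClosedFieldType) (alpha x : K) (N n : nat) :
  alpha^* = alpha -> x * x^* = 1 -> (n <= N)%N ->
  binom_sum alpha n x * (binom_sum alpha n x)^* = normsq_sum alpha ((2 + x + x^*) / 4) N.+1 n.
Proof.
move=> ra x1; set t := _ / 4 => nN.
have x0 : x != 0 by apply/eqP => x0; move: x1; rewrite x0 mul0r => /eqP; rewrite eq_sym oner_eq0.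
have xc : x^* = x^-1 by rewrite -[RHS]mulr1 -x1 mulKf.
pose c n := binom_sum alpha n x.
pose X n := re_sum alpha t N.+1 n; pose s n := im_sum alpha t N.+1 n.
pose D n := normsq_sum alpha t N.+1 n.
suff /(_ n nN) [] : forall m, (m <= N)%N ->
  [/\ c m * (c m)^* = D m, c m.+1 * (c m.+1)^* = D m.+1,
   c m.+1 * (c m)^* = (1 + x) * (alpha * X m) + (1 - x) * s m &
   c m * (c m.+1)^* = (1 + x^-1) * (alpha * X m) + (1 - x^-1) * s m] by [].
elim=> [_|m IHm mN].
  rewrite /c /X /s /D binom_sum0 binom_sum1 conjC0 conjC1 normsq_sum0 normsq_sum1 re_sum0 im_sum0.
  by split; ring.
have [D0 D1 E0 E0c] := IHm (ltnW mN).
have v0 : (m.+1%:R : K) != 0 by rewrite pnatr_eq0.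
have b1 : c m.+2 = (alpha / m.+1%:R * (1 + x) + (1 - x)) * c m.+1 + x * c m.
  apply: (mulfI v0); rewrite /c binom_sum_rec; move: (m.+1%:R : K) v0 => v v0.
  by field.
have b2 : (c m.+2)^* = (alpha / m.+1%:R * (1 + x^-1) + (1 - x^-1)) * (c m.+1)^* + x^-1 * (c m)^*.
  by rewrite b1 !(rmorphD, rmorphM, rmorphN, fmorphV, rmorph1) /= conjC_nat ra xc.
have X1 : X m.+1 = X m + D m.+1 / m.+1%:R.
  by rewrite /D -re_sumS mulrC mulKf // addrC subrK.
have s1 : s m.+1 = D m.+1 - s m by rewrite /D normsq_sumS addrK.
have D2 := @normsq_sum_rec K alpha t N m mN; rewrite -/(D _) -/(D _) -/(s _) -/(s _) -/(X _) -/(X _) in D2.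
have tE : t = (2 + x + x^-1) / 4 by rewrite /t xc.
split=> //.
- rewrite b2 b1 D2 X1 s1 -/(D m) -D0 tE.
  set P := alpha / m.+1%:R * (1 + x) + (1 - x).
  set Q := alpha / m.+1%:R * (1 + x^-1) + (1 - x^-1).
  transitivity (P * Q * (c m.+1 * (c m.+1)^*) + P * x^-1 * (c m.+1 * (c m)^*)
    + Q * x * (c m * (c m.+1)^*) + (x * x^-1) * (c m * (c m)^*)); first ring.
  rewrite D1 E0 E0c /P /Q.
  move: (m.+1%:R : K) v0 (X m) (s m) (D m.+1) (c m * _) => v v0 X' s' D' C'.
  by field; rewrite x0 v0.
- rewrite b1 mulrDl -!mulrA D1 E0c X1 s1.
  move: (m.+1%:R : K) v0 (X m) (s m) (D m.+1) => v v0 X' s' D'.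
  by field; rewrite x0 v0.
- rewrite b2 mulrDr mulrCA D1 (mulrCA _ x^-1) E0 X1 s1.
  move: (m.+1%:R : K) v0 (X m) (s m) (D m.+1) => v v0 X' s' D'.
  by field; rewrite x0 v0.
Qed.

(** * Chebyshev polynomials and the nonnegative starting polynomial *)

(* The Chebyshev value [U_{n-1}(1 - 2 t)], provided [n <= N]. *)
Definition chebsum (R : comNzRingType) (t : R) (N n : nat) : R :=
  \sum_(k < N) 'C(n + k, k.*2.+1)%:R * (- 4 * t) ^+ k.

Lemma chebsum_rec (R : comNzRingType) (t : R) (N n : nat) : (n.+1 <= N)%N ->
  chebsum t N.+1 n.+2 = (2 - 4 * t) * chebsum t N.+1 n.+1 - chebsum t N.+1 n.
Proof.
move=> nN; apply/eqP; rewrite -subr_eq0; apply/eqP.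
transitivity ((chebsum t N.+1 n.+2 - 2 * chebsum t N.+1 n.+1 + chebsum t N.+1 n)
   + 4 * t * chebsum t N.+1 n.+1); first ring.
rewrite [X in X + _](_ : _ = \sum_(k < N.+1) ('C(n.+2 + k, k.*2.+1)%:R
  - 2 * 'C(n.+1 + k, k.*2.+1)%:R + 'C(n + k, k.*2.+1)%:R) * (- 4 * t) ^+ k); last first.
  rewrite /chebsum mulr_sumr -sumrB -big_split /=; apply: eq_bigr => k _; ring.
rewrite big_ord_recl /chebsum mulr_sumr [X in _ + X = _]big_ord_recr /=.
rewrite (@bin_small (n.+1 + N)); last lia.
rewrite mul0r mulr0 addr0 !addn0 !bin1 -addrA -big_split /=.
rewrite [X in X + _](_ : _ = 0) ?add0r; last by rewrite -(natr1 n.+1) -(natr1 n); ring.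
rewrite big1 // => k _; rewrite /bump /= add1n doubleS !addnS !addSn exprS.
rewrite !binS !natrD; ring.
Qed.

Lemma chebsum0 (R : comNzRingType) (t : R) (N : nat) : chebsum t N 0 = 0.
Proof.
by rewrite /chebsum big1 // => k _; rewrite bin_small ?mul0r //; lia.
Qed.

Lemma chebsum1 (R : comNzRingType) (t : R) (N : nat) : chebsum t N.+1 1 = 1.
Proof.
rewrite /chebsum big_ord_recl /= bin1 expr0 !mulr1.
by rewrite big1 ?addr0 // => k _; rewrite bin_small ?mul0r // /bump; lia.
Qed.

(** The recurrence preserves a quadratic form in two consecutive values. Completing the square gives
    [|V_{m+1} - (1 - 2t) V_m| <= 1], hence [|V_{m+1}| <= 1 + |V_m|]. *)
Lemma chebsum_le (R : realDomainType) (t : R) (N n : nat) : (n <= N)%N ->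
  0 <= t <= 1 -> chebsum t N.+1 n <= n%:R.
Proof.
move=> nN t01; pose V m := chebsum t N.+1 m.
suff /(_ n nN) [_ +] : forall m, (m <= N)%N ->
    V m.+1 ^+ 2 - 2 * (1 - 2 * t) * V m.+1 * V m + V m ^+ 2 = 1 /\ `|V m| <= m%:R.
  exact: le_trans (ler_norm _).
elim=> [_|m IHm mN].
  by rewrite /V chebsum0 chebsum1 normr0; split=> //; ring.
have [inv bd] := IHm (ltnW mN); split.
  by rewrite /V chebsum_rec // -[RHS]inv /V; ring.
have t2 : `|V m.+1 - (1 - 2 * t) * V m| <= 1.
  rewrite -(@ler_pXn2r _ 2) ?nnegrE // expr1n real_normK ?num_real //.
  have -> : (V m.+1 - (1 - 2 * t) * V m) ^+ 2 = 1 - 4 * (t * (1 - t)) * V m ^+ 2.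
    by rewrite -[X in _ = X - _]inv; ring.
  case/andP: t01 => t0 t1.
  by rewrite gerBl mulr_ge0 ?sqr_ge0 // mulr_ge0 // mulr_ge0 ?subr_ge0.
have t3 : `|1 - 2 * t| <= 1 by rewrite ler_norml; lra.
rewrite -(subrK ((1 - 2 * t) * V m) (V m.+1)) (le_trans (ler_normD _ _)) //.
rewrite -(natr1 m) (addrC m%:R) lerD // normrM (le_trans _ bd) //.
by rewrite ler_piMl.
Qed.

(** Coefficients of [(n - U_{n-1}(1 - 2t)) / (4t)] in powers of [t]. *)
Definition chebcoef (R : pzRingType) (n k : nat) : R :=
  (- 4) ^+ k * 'C(n + k.+1, k.*2.+3)%:R.

Lemma chebcoef_ge0 (R : realDomainType) (t : R) (N n : nat) : (n <= N)%N ->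
  0 <= t <= 1 -> 0 <= \sum_(k < N) chebcoef R n k * t ^+ k.
Proof.
move=> nN t01.
have e : n%:R - chebsum t N.+1 n = 4 * t * \sum_(k < N) chebcoef R n k * t ^+ k.
  rewrite /chebsum big_ord_recl /= addn0 bin1 expr0 mulr1 opprD addNKr.
  rewrite mulr_sumr -sumrN; apply: eq_bigr => k _.
  by rewrite /bump /= add1n doubleS /chebcoef exprS exprMn; ring.
(* At [t = 0] one cannot divide by [4t]; only the constant term [C(n+1, 3)] is left. *)
have [t0|t0] := eqVneq t 0.
  case: N {nN e} => [|N]; first by rewrite big_ord0.
  rewrite big_ord_recl big1 => [|k _]; last by rewrite t0 expr0n mulr0.
  by rewrite /chebcoef !expr0 mul1r mulr1 addr0.
have t1 : 0 < 4 * t by lra.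
by rewrite -(pmulr_rge0 _ t1) -e subr_ge0 chebsum_le.
Qed.

(** * Coefficient multipliers that preserve nonnegativity on [[0, 1]] *)

(* If [p] were negative at [t1], then to the right of its last zero before [t1]
   the hypothesis would force [p' > 0]. *)
Lemma poly_ge0_of_euler (R : rcfType) (p : {poly R}) (c : R) : 0 < c ->
  (forall t : R, 0 <= t <= 1 -> 0 <= t * p^`().[t] + c * p.[t]) ->
  forall t : R, 0 <= t <= 1 -> 0 <= p.[t].
Proof.
move=> c0 H t1 t101; rewrite leNgt; apply/negP => pt1.
have p0 : 0 <= p.[0].
  have := H 0; rewrite lexx ler01 => /(_ isT).
  by rewrite mul0r add0r pmulr_rge0.
have pn0 : p != 0 by apply: contraTneq pt1 => ->; rewrite horner0 ltxx.
have t1_gt0 : 0 < t1.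
  rewrite lt_def; case/andP: t101 => -> _; rewrite andbT.
  by apply: contraTneq pt1 => ->; rewrite -leNgt.
have zlt := prev_root_lt t1_gt0 pn0.
have nr := @prev_noroot _ p 0 t1.
have zin := prev_root_in p 0 t1.
(* The point is the last root before [t1], or 0 if there is none. *)
have pz : 0 <= p.[prev_root p 0 t1].
  by case: prev_rootP => [-> |y _ -> //|d _ ->]; rewrite ?horner0 // (min_l (ltW t1_gt0)).
move: (prev_root p 0 t1) zlt nr zin pz => z zlt nr zin pz.
have z0 : 0 <= z by move: zin; rewrite (min_l (ltW t1_gt0)) in_itv => /andP[].
have [x xin pE] := poly_mvt p zlt.
have [xz xt1] : z < x /\ x < t1 by move: xin; rewrite in_itv /= => /andP[].
have px : p.[x] < 0.
  rewrite lt_neqAle; have := nr x xin; rewrite rootE => -> /=.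
  rewrite leNgt; apply/negP => px.
  have [|y yin ry] := @poly_ivtoo _ p x t1 (ltW xt1).
    by rewrite pmulr_rlt0.
  suff /nr : y \in `]z, t1[ by rewrite ry.
  by move: yin; rewrite !in_itv /= => /andP[xy ->]; rewrite (lt_trans xz).
have x01 : 0 <= x <= 1 by lra.
have dx : 0 < p^`().[x].
  have := H x x01 => h; have x0 : 0 < x by lra.
  rewrite -(pmulr_rgt0 _ x0); have := c0; nra.
have : 0 < p.[t1] - p.[z] by rewrite pE mulr_gt0 // subr_gt0.
lra.
Qed.

Definition nonneg01 (R : numDomainType) (N : nat) (u : nat -> R) : Prop :=
  forall t : R, 0 <= t <= 1 -> 0 <= \sum_(k < N) u k * t ^+ k.

Lemma deriv_poly_def (R : nzRingType) (N : nat) (u : nat -> R) :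
  (\poly_(k < N.+1) u k)^`() = \poly_(k < N) (u k.+1 *+ k.+1).
Proof.
apply/polyP => k; rewrite coef_deriv !coef_poly ltnS.
by case: ltnP => // _; rewrite mul0rn.
Qed.

(** The polynomial [p] with the divided coefficients satisfies [t p' + c p = sum_k u_k t^k]. *)
Lemma nonneg01_div (R : rcfType) (N : nat) (u : nat -> R) (c : R) :
  0 < c -> nonneg01 N u -> nonneg01 N (fun k => u k / (k%:R + c)).
Proof.
move=> c0 uP t t01.
pose p := \poly_(k < N) (u k / (k%:R + c)).
suff : 0 <= p.[t] by rewrite horner_poly.
apply: (@poly_ge0_of_euler _ p c c0) => // s s01.
suff <- : (\poly_(k < N) u k).[s] = s * p^`().[s] + c * p.[s].
  by rewrite horner_poly uP.
suff -> : \poly_(k < N) u k = 'X * p^`() + c *: p by rewrite !hornerE.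
apply/polyP => k; rewrite coefD coefXM coefZ coef_deriv !coef_poly.
have kc : k%:R + c != 0 by rewrite gt_eqF // ltr_wpDl.
case: k kc => [|k] kc /=; case: ifP => _; rewrite ?mulr0 ?mul0rn ?addr0 //.
  by rewrite !add0r in kc *; rewrite mulrC divfK.
rewrite -[X in _ = X + _]mulr_natl; move: (k.+1%:R : R) kc => v kc.
by field.
Qed.

(** Its values at [2, ..., k+1] are the reciprocals of the factors of [mu_k]. *)
Definition shift_factor (R : fieldType) (alpha : R) (y : nat) : R :=
  (y%:R ^+ 2 - 1) / (y%:R ^+ 2 - alpha ^+ 2).

(** Dividing by [k + (y - alpha)] and by [k + (y + alpha)] needs [alpha < y], whence the bound
    [alpha < 2]; [alpha >= 1] makes the weight [alpha^2 - 1] nonnegative. *)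
Lemma nonneg01_factor (R : rcfType) (N : nat) (u : nat -> R) (alpha : R) (y : nat) :
  1 <= alpha < 2 -> (2 <= y)%N -> nonneg01 N u ->
  nonneg01 N (fun k => u k * shift_factor alpha (k + y)).
Proof.
move=> /andP[a1 a2] y2 uP.
have y2r : 2 <= y%:R :> R by rewrite ler_nat.
have c1 : 0 < y%:R - alpha by lra.
have c2 : 0 < y%:R + alpha by lra.
have uP' := nonneg01_div c2 (nonneg01_div c1 uP).
move=> t t01; have := uP t t01; have := uP' t t01.
set A := \sum_(k < N) _; set B := \sum_(k < N) _ => A0 B0.
suff -> : \sum_(k < N) u k * shift_factor alpha (k + y) * t ^+ k = B + (alpha ^+ 2 - 1) * A.
  by rewrite addr_ge0 // mulr_ge0 // subr_ge0 exprn_ege1.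
rewrite /A /B mulr_sumr -big_split; apply: eq_bigr => k _ /=.
rewrite /shift_factor natrD.
have k0 : 0 <= k%:R :> R by rewrite ler0n.
have h1 : k%:R + (y%:R - alpha) != 0 by rewrite gt_eqF //; lra.
have h2 : k%:R + (y%:R + alpha) != 0 by rewrite gt_eqF //; lra.
rewrite [_ - alpha ^+ 2](_ : _ = (k%:R + (y%:R - alpha)) * (k%:R + (y%:R + alpha))); last ring.
by move: (k%:R : R) (y%:R : R) h1 h2 => v w h1 h2; field; rewrite h1 h2.
Qed.

Lemma nonneg01_factors (R : rcfType) (N M : nat) (u : nat -> R) (alpha : R) :
  1 <= alpha < 2 -> nonneg01 N u ->
  nonneg01 N (fun k => u k * \prod_(i < M) shift_factor alpha (k + i.+2)).
Proof.
move=> a12 uP; elim: M => [|M IHM] t t01.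
  by under eq_bigr => k _ do rewrite big_ord0 mulr1; exact: uP.
have := @nonneg01_factor _ _ _ alpha M.+2 a12 isT IHM t t01.
by under [in X in _ -> X]eq_bigr => k _ do rewrite big_ord_recr /= mulrA.
Qed.

Lemma shift_factor_gt0 (R : realFieldType) (alpha : R) (y : nat) :
  1 <= alpha < 2 -> (2 <= y)%N -> 0 < shift_factor alpha y.
Proof.
move=> /andP[a1 a2] y2; have y2r : 2 <= y%:R :> R by rewrite ler_nat.
by rewrite /shift_factor divr_gt0 //; nra.
Qed.

Lemma cvg_shift_factor (R : realType) (alpha : R) (i : nat) : 1 <= alpha < 2 ->
  (shift_factor alpha (M + i.+2) @[M --> \oo] --> (1 : R))%classic.
Proof.
(* With [y = M + i + 2], the bounds [y - alpha >= 2 - alpha] and [y + alpha >= M + 1] place the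
   factor between [1] and [1 + C / (M + 1)]. *)
move=> /andP[a1 a2]; pose C := (alpha ^+ 2 - 1) / (2 - alpha).
have C0 : 0 <= C by rewrite divr_ge0 ?subr_ge0 ?exprn_ege1 // ltW.
have h : (1 + C * harmonic M @[M --> \oo] --> (1 : R))%classic.
  rewrite -[X in (_ --> X)%classic]addr0 -[X in (_ --> _ + X)%classic](mulr0 C).
  by apply: cvgD; [exact: cvg_cst|apply: cvgM; [exact: cvg_cst|exact: cvg_harmonic]].
apply: (@squeeze_cvgr _ _ _ _ (fun=> 1) _ _ _ _ _ h); last exact: cvg_cst.
near=> M.
have k0 : 0 <= i%:R :> R by rewrite ler0n.
have M0 : 0 <= M%:R :> R by rewrite ler0n.
rewrite /shift_factor natrD -(natr1 i.+1) -(natr1 i) /harmonic /=.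
set y := M%:R + _.
have y1 : 2 - alpha <= y - alpha by rewrite /y; lra.
have y2 : M%:R + 1 <= y + alpha by rewrite /y; lra.
have d0 : 0 < y ^+ 2 - alpha ^+ 2 by rewrite subr_sqr mulr_gt0 //; lra.
have -> : (y ^+ 2 - 1) / (y ^+ 2 - alpha ^+ 2) = 1 + (alpha ^+ 2 - 1) / (y ^+ 2 - alpha ^+ 2).
  by field; rewrite gt_eqF.
have s0 : 0 <= alpha ^+ 2 - 1 by rewrite subr_ge0 exprn_ege1.
apply/andP; split; first by rewrite lerDl divr_ge0 // ltW.
rewrite lerD2l /C -mulrA ler_wpM2l // -natr1 -invfM lef_pV2 ?posrE //.
  by rewrite subr_sqr ler_pM //; lra.
by rewrite mulr_gt0 //; lra.
Unshelve. all: by end_near. Qed.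

(** The product of [f] over [i < k + M] can be split at [k] or at [M]. *)
Lemma prod_shift (R : fieldType) (f : nat -> R) (k M : nat) :
  (forall i, f i != 0) ->
  \prod_(i < M) f (k + i)%N =
  \prod_(i < M) f i * (\prod_(i < k) f (M + i)%N / \prod_(i < k) f i).
Proof.
move=> f0.
have e : \prod_(i < k) f i * \prod_(i < M) f (k + i)%N =
         \prod_(i < M) f i * \prod_(i < k) f (M + i)%N.
  transitivity (\prod_(i < k + M) f i); first by rewrite big_split_ord.
  by rewrite addnC big_split_ord.
have p0 : \prod_(i < k) f i != 0 by apply/prodf_neq0 => i _.
by rewrite mulrA -e mulrC mulKf.
Qed.

(** After [M] multipliers, dividing by the positive product of [shift_factor alpha (i+2)] over
    [i < M], which is independent of [k], leaves the wanted coefficient times [L k M], and [L k M]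
    tends to 1. *)
Lemma nonneg01_limit (R : realType) (N : nat) (u : nat -> R) (alpha : R) :
  1 <= alpha < 2 -> nonneg01 N u ->
  nonneg01 N (fun k => u k / \prod_(i < k) shift_factor alpha i.+2).
Proof.
move=> a12 uP t t01.
have f0 i : shift_factor alpha i.+2 != 0 by rewrite gt_eqF // shift_factor_gt0.
pose L k M := \prod_(i < k) shift_factor alpha (M + i).+2.
have cvL k : (L k M @[M --> \oo] --> (1 : R))%classic.
  elim: k => [|k IHk].
    by rewrite (_ : L 0%N = fun=> 1); [exact: cvg_cst | apply/funext => M; rewrite /L big_ord0].
  rewrite (_ : L k.+1 = fun M => L k M * shift_factor alpha (M + k.+2)).
    by have := cvgM IHk (cvg_shift_factor k a12); rewrite mulr1; apply.
  by apply/funext => M; rewrite /L big_ord_recr /= !addnS.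
pose S M := \sum_(k < N) u k / \prod_(i < k) shift_factor alpha i.+2 * L k M * t ^+ k.
have S0 M : 0 <= S M.
  have P0 : 0 < \prod_(i < M) shift_factor alpha i.+2.
    by apply: prodr_gt0 => i _; exact: shift_factor_gt0.
  rewrite -(pmulr_rge0 _ P0).
  suff -> : \prod_(i < M) shift_factor alpha i.+2 * S M =
      \sum_(k < N) u k * \prod_(i < M) shift_factor alpha (k + i.+2) * t ^+ k.
    exact: nonneg01_factors.
  rewrite /S mulr_sumr; apply: eq_bigr => k _.
  under [in RHS]eq_bigr => i _ do rewrite !addnS.
  rewrite (@prod_shift _ (fun i => shift_factor alpha i.+2)) // /L.
  ring.
have cvS : (S M @[M --> \oo] --> \sum_(k < N) u k / \prod_(i < k) shift_factor alpha i.+2 * t ^+ k)%classic.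
  apply: (@cvg_big _ _ +%R) => // [|k _]; first exact: add_continuous.
  apply: (@cvgM _ _ _ _ _ (fun=> t ^+ k)); last exact: cvg_cst.
  rewrite -[X in (_ --> X)%classic]mulr1.
  by apply: cvgM; [exact: cvg_cst | exact: cvL].
rewrite -(cvg_lim _ cvS) //; apply: limr_ge; first by apply/cvg_ex; eexists; exact: cvS.
by near=> M; exact: S0.
Unshelve. all: by end_near. Qed.

(** * Monotonicity of [|c_n|^2] in [t] *)

Lemma normsq_ratioE (R : rcfType) (alpha : R) (k : nat) : 1 <= alpha < 2 ->
  normsq_ratio alpha k.+1 *+ k.+1 =
  2 * (alpha ^+ 2 - 1) * ((- 4) ^+ k / \prod_(i < k) shift_factor alpha i.+2).
Proof.
move=> a12; elim: k => [|k IHk].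
  by rewrite /normsq_ratio big_ord1 big_ord0 expr0 divr1 mulr1n /=; field.
have w0 : shift_factor alpha k.+2 != 0 by rewrite gt_eqF // shift_factor_gt0.
have p0 : \prod_(i < k) shift_factor alpha i.+2 != 0.
  by apply/prodf_neq0 => i _; rewrite gt_eqF // shift_factor_gt0.
have d0 : k.+2%:R ^+ 2 - alpha ^+ 2 != 0.
  by apply: contra_neq w0 => e; rewrite /shift_factor e invr0 mulr0.
have k1 : k.+1%:R != 0 :> R by rewrite pnatr_eq0.
have k2 : k.+2%:R != 0 :> R by rewrite pnatr_eq0.
have k3 : k.+3%:R != 0 :> R by rewrite pnatr_eq0.
(* The quotient of consecutive terms is [4 (alpha^2 - (k+2)^2) / ((k+1)(k+3))], and
   [(k+1)(k+3) = (k+2)^2 - 1]. *)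
have step : normsq_ratio alpha k.+2 *+ k.+2 =
    normsq_ratio alpha k.+1 *+ k.+1 * (- 4 / shift_factor alpha k.+2).
  rewrite -[LHS]mulr_natr -(mulr_natr (normsq_ratio alpha k.+1)).
  rewrite {1}/normsq_ratio big_ord_recr /= -/(normsq_ratio alpha k.+1).
  have e1 : k.+1%:R = k.+2%:R - 1 :> R by rewrite -(natr1 k.+1) addrK.
  have e3 : k.+3%:R = k.+2%:R + 1 :> R by rewrite natr1.
  rewrite /shift_factor e1 e3; rewrite e1 in k1; rewrite e3 in k3.
  rewrite invf_div (_ : k.+2%:R ^+ 2 - 1 = (k.+2%:R - 1) * (k.+2%:R + 1)); last first.
    by ring.
  move: (normsq_ratio alpha k.+1) (k.+2%:R : R) (alpha ^+ 2) k1 k2 k3 => g y A k1 k2 k3.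
  by field; rewrite k1 k2 k3.
rewrite step IHk big_ord_recr /= (exprS (- 4)) (invfM (\prod_(i < k) _)).
ring.
Qed.

(** Mean value theorem: the derivative has the coefficients
    [2 (alpha^2 - 1) n mu_k chebcoef R n k]. *)
Lemma normsq_sum_le (R : realType) (alpha t : R) (N n : nat) : (n <= N)%N ->
  1 <= alpha < 2 -> 0 <= t <= 1 -> normsq_sum alpha t N.+1 n <= normsq_sum alpha 1 N.+1 n.
Proof.
move=> nN a12 /andP[t0]; rewrite le_eqVlt => /predU1P[-> //|t1].
pose p := \poly_(k < N.+1) (normsq_ratio alpha k * (n * 'C(n + k, k.*2.+1))%:R).
have pE s : normsq_sum alpha s N.+1 n = p.[s] by rewrite horner_poly.
rewrite !pE -subr_ge0; have [x xin ->] := poly_mvt p t1.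
have x01 : 0 <= x <= 1.
  by move: xin; rewrite in_itv /= => /andP[? ?]; apply/andP; split; lra.
rewrite mulr_ge0 ?subr_ge0 ?(ltW t1) // deriv_poly_def horner_poly.
have chP : nonneg01 N (chebcoef R n) by move=> s s01; exact: chebcoef_ge0.
have := nonneg01_limit a12 chP x01.
have c0 : 0 <= 2 * (alpha ^+ 2 - 1) * n%:R.
  by rewrite !mulr_ge0 ?subr_ge0 ?exprn_ege1 //; case/andP: a12.
move=> /(mulr_ge0 c0); congr (0 <= _); rewrite mulr_sumr; apply: eq_bigr => k _.
rewrite -mulrnAl normsq_ratioE // /chebcoef doubleS natrM; ring.
Qed.

(** * From the hypergeometric series to [c_n] *)

Lemma pochhammer2 (K : numFieldType) (k : nat) :
  pochhammer (2 : K) k = k.+1`!%:R.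
Proof.
elim: k => [|k IHk]; first by rewrite /pochhammer big_ord0.
rewrite /pochhammer big_ord_recr /= -/(pochhammer _ _) IHk (factS k.+1).
by rewrite natrM mulrC -natrD.
Qed.

Lemma pochhammer_sub1 (K : numFieldType) (a : K) (k : nat) :
  pochhammer (1 - a) k = (- 1) ^+ k * (k`!%:R * gbinom (a - 1) k).
Proof.
rewrite /gbinom (mulrC k`!%:R) divfK; last by rewrite pnatr_eq0 -lt0n fact_gt0.
elim: k => [|k IHk]; first by rewrite /pochhammer !big_ord0 mulr1.
rewrite /pochhammer !big_ord_recr /= -/(pochhammer _ _) IHk exprS; ring.
Qed.

Lemma pochhammer_subn (K : numFieldType) (n k : nat) :
  n%:R * pochhammer (1 - n%:R : K) k = (- 1) ^+ k * (n ^_ k.+1)%:R.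
Proof.
elim: k => [|k IHk]; first by rewrite /pochhammer big_ord0 mulr1 mul1r ffactn1.
rewrite /pochhammer big_ord_recr /= -/(pochhammer _ _) mulrA IHk.
rewrite (ffactnSr n k.+1) natrM exprS.
(* For [n <= k] the falling factorial vanishes, so the truncated difference [n - (k+1)] is
   harmless. *)
case: (leqP k.+1 n) => nk; last by rewrite ffact_small // !mul0r !mulr0 mul0r.
rewrite (natrB _ nk) -(natr1 k).
ring.
Qed.

Lemma hyp2F1_termE (K : numFieldType) (alpha w : K) (n k : nat) : (0 < n)%N ->
  hyp2F1_term (1 - n%:R) (1 - alpha) 2 w k =
  n%:R^-1 * ('C(n, k.+1)%:R * (gbinom (alpha - 1) k * w ^+ k)).
Proof.
move=> n0.
have nn0 : n%:R != 0 :> K by rewrite pnatr_eq0 -lt0n.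
apply: (mulfI nn0); rewrite mulVKf //.
transitivity (n%:R * pochhammer (1 - n%:R) k * pochhammer (1 - alpha) k /
    (pochhammer 2 k * k`!%:R) * w ^+ k); first by rewrite /hyp2F1_term !mulrA.
rewrite pochhammer_subn pochhammer2 pochhammer_sub1 -bin_ffact natrM.
have f1 : k`!%:R != 0 :> K by rewrite pnatr_eq0 -lt0n fact_gt0.
have f2 : k.+1`!%:R != 0 :> K by rewrite pnatr_eq0 -lt0n fact_gt0.
have e : (- 1) ^+ k * (- 1) ^+ k = 1 :> K by rewrite -exprMn mulrNN mulr1 expr1n.
move: (k.+1`!%:R : K) (k`!%:R : K) ('C(n, k.+1)%:R : K) f1 f2 => a b c f1 f2.
transitivity (((- 1) ^+ k * (- 1) ^+ k) * c * gbinom (alpha - 1) k * w ^+ k); last first.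
  by rewrite e; ring.
by field; rewrite f1 f2.
Qed.

(** The partial sums are constant from index [n] on, so the limit is that constant. *)
Lemma hyp2F1_poly (K : numFieldType) (alpha x : K) (n : nat) : (0 < n)%N ->
  hyp2F1 (1 - n%:R) (1 - alpha) 2 (1 + x) = n%:R^-1 * binom_sum alpha n x.
Proof.
move=> n0; rewrite /hyp2F1; apply: lim_near_cst; first exact: norm_hausdorff.
near=> m.
have nm : (n <= m)%N by near: m; exact: nbhs_infty_ge.
rewrite (binom_sumE alpha x nm) mulr_sumr seriesEord /=.
by apply: eq_bigr => k _; rewrite hyp2F1_termE.
Unshelve. all: by end_near. Qed.

(** * Bounds on the unit circle and induction on [alpha] *)

(** At [x = 1] the recurrence has nonnegative coefficients, whereas single terms of the sum may be
    negative. *)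
Lemma binom_sum_at1_ge0 (K : numFieldType) (alpha : K) (n : nat) : 0 <= alpha ->
  0 <= binom_sum alpha n 1.
Proof.
move=> a0; suff [] : 0 <= binom_sum alpha n 1 /\ 0 <= binom_sum alpha n.+1 1 by [].
elim: n => [|n [IH1 IH2]]; first by rewrite binom_sum0 binom_sum1 lexx ler01.
split=> //; have n0 : 0 < n.+1%:R :> K by rewrite ltr0n.
rewrite -(pmulr_rge0 _ n0) binom_sum_rec subrr mulr0 addr0 mulr1.
by rewrite addr_ge0 // mulr_ge0 // ?mulr_ge0 // ?addr_ge0 ?ler01 // ltW.
Qed.

Lemma normsq_sum_rmorph (K L : numFieldType) (f : {rmorphism K -> L}) (alpha t : K)
  (N n : nat) : f (normsq_sum alpha t N n) = normsq_sum (f alpha) (f t) N n.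
Proof.
rewrite /normsq_sum rmorph_sum; apply: eq_bigr => k _ /=.
rewrite 2!rmorphM rmorphXn rmorph_nat; congr (_ * _ * _).
rewrite /normsq_ratio rmorph_prod; apply: eq_bigr => j _ /=.
by rewrite !(rmorphM, fmorphV, rmorphB, rmorphXn, rmorph_nat).
Qed.

Lemma norm_binom_sum_le_lt2 (R : realType) (alpha : R) (x : R[i]) (n : nat) :
  1 <= alpha < 2 -> `|x| = 1 ->
  `|binom_sum (alpha%:C)%C n x| <= binom_sum (alpha%:C)%C n 1.
Proof.
move=> a12 x1.
have c0 : 0 <= binom_sum (alpha%:C)%C n 1.
  by apply: binom_sum_at1_ge0; rewrite ler0c; case/andP: a12 => a1 _; exact: le_trans a1.
have ac : ((alpha%:C)%C : R[i])^* = (alpha%:C)%C by exact: conjc_real.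
(* On the circle [(2 + y + conj y) / 4 = (1 + Re y) / 2], so the squared modulus is a real
   [normsq_sum], and [y = 1] gives [t = 1]. *)
have tE (y : R[i]) : `|y| = 1 ->
    (binom_sum (alpha%:C)%C n y) * (binom_sum (alpha%:C)%C n y)^* =
      ((normsq_sum alpha ((1 + complex.Re y) / 2) n.+1 n)%:C)%C.
  move=> y1; rewrite (@binom_sum_sqr_norm _ _ _ n) //; last by rewrite -normCK y1 expr1n.
  rewrite (normsq_sum_rmorph (real_complex R)); congr (normsq_sum _ _ _ _).
  have -> : y^* = 2 * ((complex.Re y)%:C)%C - y.
    by rewrite -addcJ addrC addKr.
  by rewrite rmorphM fmorphV rmorphD rmorph1 rmorph_nat; field.
rewrite -(ger0_norm c0) -(@ler_pXn2r _ 2) ?nnegrE // !normCK.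
rewrite !tE // ?normr1 // lecR.
have -> : (1 + complex.Re (1 : R[i])) / 2 = 1 :> R by rewrite /=; field.
apply: normsq_sum_le => //.
have := normc_ge_Re x; rewrite x1 lecR ler_norml => /andP[? ?].
by apply/andP; split; lra.
Qed.

(** Triangle inequality in [binom_sum_succ], whose right-hand side at [x = 1] is exactly the sum of
    the three bounds. *)
Lemma norm_binom_sum_succ (K : numFieldType) (alpha x : K) : `|x| = 1 ->
  (forall m, `|binom_sum alpha m x| <= binom_sum alpha m 1) ->
  forall n, `|binom_sum (alpha + 1) n x| <= binom_sum (alpha + 1) n 1.
Proof.
move=> x1 IH; elim=> [|n IHn]; first by rewrite !binom_sum0 normr0.
rewrite !binom_sum_succ mul1r (le_trans (ler_normD _ _)) // lerD //.
by rewrite (le_trans (ler_normD _ _)) // normrM x1 mul1r lerD.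
Qed.

Lemma norm_binom_sum_le (R : realType) (alpha : R) (x : R[i]) (n : nat) :
  1 <= alpha -> `|x| = 1 ->
  `|binom_sum (alpha%:C)%C n x| <= binom_sum (alpha%:C)%C n 1.
Proof.
move=> a1 x1.
(* [j] bounds how often [alpha] must be lowered by 1 to land in [[1, 2)]. *)
have [j] : exists j : nat, alpha < j.+2%:R.
  exists (Num.bound alpha); apply: lt_trans (archi_boundP _) _; first lra.
  by rewrite ltr_nat; lia.
elim: j alpha n a1 => [|j IHj] alpha n a1 aj.
  by apply: norm_binom_sum_le_lt2 => //; rewrite a1 aj.
have [a2|a2] := ltP alpha 2; first by apply: norm_binom_sum_le_lt2 => //; rewrite a1 a2.
have IH m : `|binom_sum ((alpha - 1)%:C)%C m x| <= binom_sum ((alpha - 1)%:C)%C m 1.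
  apply: IHj; first lra.
  by rewrite -(natr1 j.+2) in aj; lra.
have aE : (alpha%:C)%C = ((alpha - 1)%:C)%C + 1 :> R[i].
  by rewrite -(rmorph1 (real_complex R)) -rmorphD subrK.
by rewrite aE; exact: norm_binom_sum_succ.
Qed.

Theorem lemma3 (R : realType) (n : nat) (alpha : R) (x : R[i])
    (hn : (1 <= n)%N) (halpha : 1 < alpha) (hx : `|x| = 1) (hx1 : x != -1) :
  `|Bn n alpha x| <= `|Bn n alpha 1|.
Proof.
rewrite /Bn !hyp2F1_poly // !normrM ler_wpM2l //.
rewrite (le_trans (norm_binom_sum_le n (ltW halpha) hx)) // ger0_norm //.
by rewrite binom_sum_at1_ge0 // ler0c; lra.
Qed.
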